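(* Let $F$ be a field, let $\mathbf{n}$ be a supernatural number, and let $1=n_0<n_1<n_2<\cdots$ be natural numbers with $n_t\mid n_{t+1}$ for all $t$ and $\operatorname{lcm}\{n_t\}=\mathbf{n}$. The supernatural matrix algebra $\operatorname{M}_{\mathbf{n}}(F)$ is the unital $F$-algebra generated by the matrix units $e_{w,w'}$, where $w,w'$ range over all pairs of $\mathbf{n}$-adic words of the same length, subject to the following three families of relations: (i) $e_{u,u'}e_{w,w'}=\delta_{u',w}\,e_{u,w'}$ whenever $|u|=|u'|=|w|=|w'|$; (ii) $e_{\emptyset,\emptyset}=1$, where $\emptyset$ is the empty word; (iii) $e_{w,w'}=\sum_{i=0}^{n_{t+1}/n_t-1}e_{iw,iw'}$ for every $w,w'$ of the same length $t\ge 0$.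
   Context: A supernatural number is a formal product $\prod_p p^{\alpha_p}$ over the primes, with $\alpha_p\in\mathbb{N}\cup\{\infty\}$ ($0$ allowed). The supernatural matrix algebra $\operatorname{M}_{\mathbf{n}}(F)$ is the direct limit of the matrix algebras $\operatorname{M}_n(F)$ over the natural divisors $n$ of $\mathbf{n}$, with the maps $\operatorname{M}_m(F)\to\operatorname{M}_n(F)$, $x\mapsto x\otimes 1=\operatorname{diag}(x,\dots,x)$, whenever $m\mid n$. An $\mathbf{n}$-adic word of length $t\geq 0$ (with respect to the fixed chain $(n_t)$) is a sequence $w=k_{t-1}\cdots k_0$ of digits with $0\le k_i<n_{i+1}/n_i$; it represents the natural number $k_0+k_1n_1+\cdots+k_{t-1}n_{t-1}$, and $|w|=t$ denotes its length (leading zeros are counted). Words of length $t$ thus index the rows and columns ($0,\dots,n_t-1$) of $n_t\times n_t$ matrices, and for $|w|=|w'|=t$ the symbol $e_{w,w'}$ denotes the corresponding matrix unit of $\operatorname{M}_{n_t}(F)$. For a word $w$ of length $t$ and $0\le i<n_{t+1}/n_t$, $iw$ is the word of length $t+1$ obtained by adding the digit $i$ on the left. *)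

(* Defs.v *)
From HB Require Import structures.
From mathcomp Require Import all_boot all_order all_algebra.
From mathcomp Require Import generic_quotient boolp.
From mathcomp.multinomials Require Import monalg.

Set Implicit Arguments.
Unset Strict Implicit.
Unset Printing Implicit Defensive.

Import GRing.Theory.
Local Open Scope ring_scope.
Local Open Scope quotient_scope.

(* The exponent [None] stands for infinity. *)
Definition supernatural := {p : nat | prime p} -> option nat.

Definition exp_le (a b : option nat) : bool :=
  match b, a with
  | None, _ => true
  | Some _, None => false
  | Some l, Some k => (k <= l)%N
  end.

Definition sn_dvd (a b : supernatural) : Prop := forall p, exp_le (a p) (b p).

(* Meaningful for n > 0 only: [logn p 0 = 0]. *)
Definition sn_of_nat (n : nat) : supernatural :=
  fun p => Some (logn (val p) n).

Definition is_sn_lcm (n : nat -> nat) (s : supernatural) : Prop :=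
  (forall t, sn_dvd (sn_of_nat (n t)) s) /\
  (forall s', (forall t, sn_dvd (sn_of_nat (n t)) s') -> sn_dvd s s').

(* The k x k matrix diag(x, ..., x) with k / m diagonal blocks, for m %| k. *)
Definition diag_rep (R : pzRingType) (m k : nat) (m_gt0 : (0 < m)%N)
    (x : 'M[R]_m) : 'M[R]_k :=
  \matrix_(i, j)
    if (i %/ m == j %/ m)%N
    then x (Ordinal (ltn_pmod i m_gt0)) (Ordinal (ltn_pmod j m_gt0)) else 0.

Section DiagRep.
Variable R : pzRingType.
Implicit Types m k l : nat.

Lemma diag_rep_id m (m_gt0 : (0 < m)%N) (x : 'M[R]_m) :
  diag_rep m m_gt0 x = x.
Proof.
apply/matrixP => i j; rewrite mxE !divn_small ?eqxx //.
by congr (x _ _); apply: val_inj; rewrite /= modn_small.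
Qed.

Lemma diag_rep_comp m k l (m_gt0 : (0 < m)%N) (k_gt0 : (0 < k)%N)
    (x : 'M[R]_m) : (m %| k)%N ->
  diag_rep l k_gt0 (diag_rep k m_gt0 x) = diag_rep l m_gt0 x.
Proof.
move=> mk; apply/matrixP => i j; rewrite !mxE /=.
have E (a b : nat) :
    (a %/ m == b %/ m)%N =
    (a %/ k == b %/ k)%N && (a %% k %/ m == b %% k %/ m)%N.
  have q_gt0 : (0 < k %/ m)%N by rewrite divn_gt0 // dvdn_leq.
  have D (c : nat) : (c %/ m = c %/ k * (k %/ m) + c %% k %/ m)%N.
    rewrite {1}(divn_eq c k) divnDl ?dvdn_mull // muln_divA //.
  have L (c : nat) : (c %% k %/ m < k %/ m)%N.
    by rewrite ltn_divLR // divnK // ltn_pmod.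
  apply/eqP/andP => [|[/eqP e1 /eqP e2]]; last by rewrite D e1 e2 -D.
  rewrite (D a) (D b) => e; split; apply/eqP.
    have := congr1 (fun c => c %/ (k %/ m))%N e.
    by rewrite /= !divnMDl // !(divn_small (L _)) !addn0.
  have := congr1 (fun c => c %% (k %/ m))%N e.
  by rewrite /= !modnMDl !(modn_small (L _)).
rewrite (E i j); case: eqP => //= _; case: eqP => // _.
by congr (x _ _); apply: val_inj; rewrite /= modn_dvdm.
Qed.

Lemma diag_repD m k (m_gt0 : (0 < m)%N) (x y : 'M[R]_m) :
  diag_rep k m_gt0 (x + y) = diag_rep k m_gt0 x + diag_rep k m_gt0 y.
Proof. by apply/matrixP => i j; rewrite !mxE; case: eqP; rewrite ?addr0. Qed.

Lemma diag_repZ m k (m_gt0 : (0 < m)%N) (a : R) (x : 'M[R]_m) :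
  diag_rep k m_gt0 (a *: x) = a *: diag_rep k m_gt0 x.
Proof. by apply/matrixP => i j; rewrite !mxE; case: eqP; rewrite ?mulr0. Qed.

Lemma diag_rep0 m k (m_gt0 : (0 < m)%N) :
  diag_rep k m_gt0 (0 : 'M[R]_m) = 0.
Proof. by apply/matrixP => i j; rewrite !mxE; case: eqP. Qed.

Lemma diag_rep1 m k (m_gt0 : (0 < m)%N) :
  diag_rep k m_gt0 (1%:M : 'M[R]_m) = 1%:M.
Proof.
apply/matrixP => i j; rewrite !mxE.
rewrite -[i == j]/(i == j :> nat) -[Ordinal _ == _]/(i %% m == j %% m)%N.
case: (i =P j :> nat) => [->|ij]; first by rewrite !eqxx.
case: eqP => // e1; case: eqP => // e2; case: ij.
by rewrite (divn_eq i m) e1 e2 -divn_eq.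
Qed.

Lemma diag_repM m k (m_gt0 : (0 < m)%N) (x y : 'M[R]_m) : (m %| k)%N ->
  diag_rep k m_gt0 (x *m y) = diag_rep k m_gt0 x *m diag_rep k m_gt0 y.
Proof.
move=> mk; apply/matrixP => i j; rewrite !mxE.
under [RHS]eq_bigr do rewrite !mxE.
case: (eqVneq (i %/ m)%N (j %/ m)%N) => ij; last first.
  rewrite big1 // => c _; case: (eqVneq (i %/ m)%N) => [<-|]; last first.
    by rewrite mul0r.
  by rewrite (negPf ij) mulr0.
rewrite -ij [RHS](bigID (fun c : 'I_k => i %/ m == c %/ m)%N) /=.
rewrite [X in _ + X]big1 ?addr0; last first.
  by move=> c /negPf ->; rewrite mul0r.
have lt_k (c : 'I_m) : (i %/ m * m + c < k)%N.
  have : (i %/ m < k %/ m)%N by rewrite ltn_divLR // divnK.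
  move=> lt; rewrite -[X in (_ < X)%N](divnK mk).
  apply: leq_trans (leq_mul lt (leqnn m)); rewrite mulSn addnC.
  by rewrite ltn_add2r.
pose h (c : 'I_m) : 'I_k := Ordinal (lt_k c).
have hm (c : 'I_m) : Ordinal (ltn_pmod (h c) m_gt0) = c.
  by apply: val_inj; rewrite /= modnMDl modn_small.
rewrite (reindex_onto h (fun c => Ordinal (ltn_pmod c m_gt0))) /=; last first.
  by move=> c /eqP e; apply: val_inj; rewrite /= e -divn_eq.
apply: eq_big => [c|c _].
  by rewrite hm eqxx andbT divnMDl // (divn_small (ltn_ord c)) addn0 eqxx.
by rewrite hm divnMDl // (divn_small (ltn_ord c)) addn0 eqxx.
Qed.

End DiagRep.

Section SupernaturalMatrix.
Variables (F : fieldType) (s : supernatural).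

Definition is_sn_divisor (n : nat) : bool :=
  `[< (0 < n)%N /\ sn_dvd (sn_of_nat n) s >].

Definition sn_divisor := {n : nat | is_sn_divisor n}.

Implicit Types d e k : sn_divisor.

Lemma sn_divisor_gt0 d : (0 < val d)%N.
Proof. by have /asboolP[] := valP d. Qed.

Definition sn_diag d e (x : 'M[F]_(val d)) : 'M[F]_(val e) :=
  diag_rep (val e) (sn_divisor_gt0 d) x.

Definition sn_mx_rep := {d : sn_divisor & 'M[F]_(val d)}.

Definition sn_mx_sim (a b : sn_mx_rep) : bool :=
  `[< exists k, [/\ (val (tag a) %| val k)%N, (val (tag b) %| val k)%N
        & sn_diag k (tagged a) = sn_diag k (tagged b)] >].

Lemma sn_lcm_subproof d e :
  is_sn_divisor (lcmn (val d) (val e)).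
Proof.
apply/asboolP; have /asboolP[d0 dP] := valP d; have /asboolP[e0 eP] := valP e.
split=> [|p]; first by rewrite lcmn_gt0 d0.
move: (dP p) (eP p); rewrite /sn_of_nat logn_lcm //; case: (s p) => //= l.
by rewrite geq_max => -> ->.
Qed.

Definition sn_lcm d e : sn_divisor := Sub _ (sn_lcm_subproof d e).

Lemma sn_diag_comp d e k (x : 'M[F]_(val d)) : (val d %| val e)%N ->
  sn_diag k (sn_diag e x) = sn_diag k x.
Proof. exact: diag_rep_comp. Qed.

Lemma sn_mx_sim_refl : reflexive sn_mx_sim.
Proof. by move=> a; apply/asboolP; exists (tag a). Qed.

Lemma sn_mx_sim_sym : symmetric sn_mx_sim.
Proof.
by move=> a b; apply/asboolP/asboolP => -[k [? ? e]]; exists k; split.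
Qed.

Lemma sn_mx_sim_trans : transitive sn_mx_sim.
Proof.
move=> b a c /asboolP[k [ak bk e]] /asboolP[l [bl cl e']].
have kL : (val k %| val (sn_lcm k l))%N by exact: dvdn_lcml.
have lL : (val l %| val (sn_lcm k l))%N by exact: dvdn_lcmr.
apply/asboolP; exists (sn_lcm k l); split; try exact: dvdn_trans kL.
  exact: dvdn_trans lL.
rewrite -(sn_diag_comp _ _ ak) e sn_diag_comp // -(sn_diag_comp _ _ bl) e'.
by rewrite sn_diag_comp.
Qed.

Canonical sn_mx_equiv :=
  EquivRel sn_mx_sim sn_mx_sim_refl sn_mx_sim_sym sn_mx_sim_trans.

(* The direct limit of the M_n(F) over the divisors n of s. *)
Definition sn_mx : Type := {eq_quot sn_mx_equiv}.
HB.instance Definition _ := Choice.on sn_mx.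
HB.instance Definition _ := EqQuotient.on sn_mx.

Definition sn_inj d (x : 'M[F]_(val d)) : sn_mx :=
  \pi_sn_mx (Tagged (fun d => 'M[F]_(val d)) x).

Lemma sn_injP d e (x : 'M[F]_(val d)) (y : 'M[F]_(val e)) :
  sn_inj x = sn_inj y <->
  exists k, [/\ (val d %| val k)%N, (val e %| val k)%N
    & sn_diag k x = sn_diag k y].
Proof.
split=> [/eqquotP/asboolP //|H].
by apply/eqquotP/asboolP.
Qed.

Lemma sn_inj_diag d e (x : 'M[F]_(val d)) : (val d %| val e)%N ->
  sn_inj (sn_diag e x) = sn_inj x.
Proof.
by move=> de; apply/sn_injP; exists e; split; rewrite // /sn_diag diag_rep_id.
Qed.

Lemma sn_repr (a : sn_mx) : sn_inj (tagged (repr a)) = a.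
Proof. by rewrite /sn_inj taggedK reprK. Qed.

Lemma sn_mxP (a : sn_mx) : exists d (x : 'M[F]_(val d)), a = sn_inj x.
Proof. by exists (tag (repr a)), (tagged (repr a)); rewrite sn_repr. Qed.

Lemma sn_mx_lift (a : sn_mx) d :
  exists2 e, (val d %| val e)%N & exists x : 'M[F]_(val e), a = sn_inj x.
Proof.
have [e [x ->]] := sn_mxP a; exists (sn_lcm d e); first exact: dvdn_lcml.
by exists (sn_diag _ x); rewrite sn_inj_diag //; apply: dvdn_lcmr.
Qed.

Lemma sn_mxP2 (a b : sn_mx) :
  exists d (x y : 'M[F]_(val d)), a = sn_inj x /\ b = sn_inj y.
Proof.
have [d [x ->]] := sn_mxP a; have [e de [y ->]] := sn_mx_lift b d.
by exists e, (sn_diag e x), y; rewrite sn_inj_diag.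
Qed.

Lemma sn_mxP3 (a b c : sn_mx) : exists d (x y z : 'M[F]_(val d)),
  [/\ a = sn_inj x, b = sn_inj y & c = sn_inj z].
Proof.
have [d [x [y [-> ->]]]] := sn_mxP2 a b; have [e de [z ->]] := sn_mx_lift c d.
by exists e, (sn_diag e x), (sn_diag e y), z; rewrite !sn_inj_diag.
Qed.

Lemma sn_one_subproof : is_sn_divisor 1.
Proof.
by apply/asboolP; split=> // p; rewrite /sn_of_nat logn1; case: (s p).
Qed.

Definition sn_one : sn_divisor := Sub 1%N sn_one_subproof.

(* Binary operations are computed after moving both arguments to the lcm. *)
Definition sn_op (op : forall n, 'M[F]_n -> 'M[F]_n -> 'M[F]_n) (a b : sn_mx) :
    sn_mx :=
  let k := sn_lcm (tag (repr a)) (tag (repr b)) in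
  sn_inj (op (val k) (sn_diag k (tagged (repr a))) (sn_diag k (tagged (repr b)))).

Definition sn_zero_mx : sn_mx := sn_inj (0 : 'M[F]_(val sn_one)).
Definition sn_one_mx : sn_mx := sn_inj (1%:M : 'M[F]_(val sn_one)).
Definition sn_opp (a : sn_mx) : sn_mx := sn_inj (- tagged (repr a)).
Definition sn_add := sn_op (fun n x y => x + y).
Definition sn_mul := sn_op (fun n x y => x *m y).
Definition sn_scale (c : F) (a : sn_mx) : sn_mx :=
  sn_inj (c *: tagged (repr a)).

Lemma sn_op_inj (op : forall n, 'M[F]_n -> 'M[F]_n -> 'M[F]_n) :
  (forall d e (x y : 'M[F]_(val d)), (val d %| val e)%N ->
     sn_diag e (op _ x y) = op _ (sn_diag e x) (sn_diag e y)) ->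
  forall d (x y : 'M[F]_(val d)),
    sn_op op (sn_inj x) (sn_inj y) = sn_inj (op _ x y).
Proof.
move=> opE d x y; rewrite /sn_op.
set a := repr (sn_inj x); set b := repr (sn_inj y).
have /sn_injP[k [ak dk ex]] := sn_repr (sn_inj x).
have /sn_injP[l [bl dl ey]] := sn_repr (sn_inj y).
set m := sn_lcm (tag a) (tag b); pose n := sn_lcm k l.
have kn : (val k %| val n)%N by exact: dvdn_lcml.
have ln : (val l %| val n)%N by exact: dvdn_lcmr.
have am : (val (tag a) %| val m)%N by exact: dvdn_lcml.
have bm : (val (tag b) %| val m)%N by exact: dvdn_lcmr.
have mn : (val m %| val n)%N.
  by rewrite dvdn_lcm (dvdn_trans ak kn) (dvdn_trans bl ln).
have dn := dvdn_trans dk kn.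
rewrite -(sn_inj_diag _ mn) -(sn_inj_diag (op _ x y) dn) !opE // !sn_diag_comp //.
congr (sn_inj (op _ _ _)).
  by rewrite -(sn_diag_comp _ _ ak) ex sn_diag_comp.
by rewrite -(sn_diag_comp _ _ bl) ey sn_diag_comp.
Qed.

Lemma sn_un_inj (op : forall n, 'M[F]_n -> 'M[F]_n) :
  (forall d e (x : 'M[F]_(val d)), sn_diag e (op _ x) = op _ (sn_diag e x)) ->
  forall d (x : 'M[F]_(val d)),
    sn_inj (op _ (tagged (repr (sn_inj x)))) = sn_inj (op _ x).
Proof.
move=> opE d x; have /sn_injP[k [ak dk ex]] := sn_repr (sn_inj x).
by rewrite -(sn_inj_diag _ ak) -(sn_inj_diag (op _ x) dk) !opE ex.
Qed.

Lemma sn_addE d (x y : 'M[F]_(val d)) :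
  sn_add (sn_inj x) (sn_inj y) = sn_inj (x + y).
Proof. by apply: sn_op_inj => *; apply: diag_repD. Qed.

Lemma sn_mulE d (x y : 'M[F]_(val d)) :
  sn_mul (sn_inj x) (sn_inj y) = sn_inj (x *m y).
Proof. by apply: sn_op_inj => *; apply: diag_repM. Qed.

Lemma sn_scaleE c d (x : 'M[F]_(val d)) :
  sn_scale c (sn_inj x) = sn_inj (c *: x).
Proof. by apply: (sn_un_inj (op := fun n x => c *: x)) => *; apply: diag_repZ. Qed.

Lemma sn_oppE d (x : 'M[F]_(val d)) : sn_opp (sn_inj x) = sn_inj (- x).
Proof.
apply: (sn_un_inj (op := fun n x => - x)) => e k y.
by rewrite -!scaleN1r; apply: diag_repZ.
Qed.

Lemma sn_zeroE d : sn_zero_mx = sn_inj (0 : 'M[F]_(val d)).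
Proof.
by rewrite /sn_zero_mx -(@sn_inj_diag _ d) ?dvd1n // /sn_diag diag_rep0.
Qed.

Lemma sn_oneE d : sn_one_mx = sn_inj (1%:M : 'M[F]_(val d)).
Proof.
by rewrite /sn_one_mx -(@sn_inj_diag _ d) ?dvd1n // /sn_diag diag_rep1.
Qed.

Fact sn_addA : associative sn_add.
Proof.
move=> a b c; have [d [x [y [z [-> -> ->]]]]] := sn_mxP3 a b c.
by rewrite !sn_addE addrA.
Qed.

Fact sn_addC : commutative sn_add.
Proof.
move=> a b; have [d [x [y [-> ->]]]] := sn_mxP2 a b.
by rewrite !sn_addE addrC.
Qed.

Fact sn_add0 : left_id sn_zero_mx sn_add.
Proof.
by move=> a; have [d [x ->]] := sn_mxP a; rewrite (sn_zeroE d) sn_addE add0r.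
Qed.

Fact sn_addN : left_inverse sn_zero_mx sn_opp sn_add.
Proof.
move=> a; have [d [x ->]] := sn_mxP a.
by rewrite (sn_zeroE d) sn_oppE sn_addE addNr.
Qed.

HB.instance Definition _ :=
  GRing.isZmodule.Build sn_mx sn_addA sn_addC sn_add0 sn_addN.

Lemma sn_injD d (x y : 'M[F]_(val d)) : sn_inj (x + y) = sn_inj x + sn_inj y.
Proof. by rewrite -sn_addE. Qed.

Fact sn_mulA : associative sn_mul.
Proof.
move=> a b c; have [d [x [y [z [-> -> ->]]]]] := sn_mxP3 a b c.
by rewrite !sn_mulE mulmxA.
Qed.

Fact sn_mul1 : left_id sn_one_mx sn_mul.
Proof.
by move=> a; have [d [x ->]] := sn_mxP a; rewrite (sn_oneE d) sn_mulE mul1mx.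
Qed.

Fact sn_mulr1 : right_id sn_one_mx sn_mul.
Proof.
by move=> a; have [d [x ->]] := sn_mxP a; rewrite (sn_oneE d) sn_mulE mulmx1.
Qed.

Fact sn_mulDl : left_distributive sn_mul sn_add.
Proof.
move=> a b c; have [d [x [y [z [-> -> ->]]]]] := sn_mxP3 a b c.
by rewrite !(sn_mulE, sn_addE) mulmxDl.
Qed.

Fact sn_mulDr : right_distributive sn_mul sn_add.
Proof.
move=> a b c; have [d [x [y [z [-> -> ->]]]]] := sn_mxP3 a b c.
by rewrite !(sn_mulE, sn_addE) mulmxDr.
Qed.

Fact sn_one_neq0 : sn_one_mx != 0.
Proof.
apply/eqP => e; have /sn_injP[k [_ _]] :
  sn_inj (1%:M : 'M[F]_(val sn_one)) = sn_inj (0 : 'M[F]_(val sn_one)) := e.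
rewrite /sn_diag diag_rep1 diag_rep0.
pose i := Ordinal (sn_divisor_gt0 k).
move/matrixP => /(_ i i); rewrite !mxE eqxx => /eqP.
by rewrite (negPf (oner_neq0 F)).
Qed.

HB.instance Definition _ := GRing.Zmodule_isNzRing.Build sn_mx
  sn_mulA sn_mul1 sn_mulr1 sn_mulDl sn_mulDr sn_one_neq0.

Lemma sn_injM d (x y : 'M[F]_(val d)) : sn_inj (x *m y) = sn_inj x * sn_inj y.
Proof. by rewrite -sn_mulE. Qed.

Fact sn_scaleA c c' a : sn_scale c (sn_scale c' a) = sn_scale (c * c') a.
Proof.
by have [d [x ->]] := sn_mxP a; rewrite !sn_scaleE scalerA.
Qed.

Fact sn_scale1 : left_id 1 sn_scale.
Proof.
by move=> a; have [d [x ->]] := sn_mxP a; rewrite sn_scaleE scale1r.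
Qed.

Fact sn_scaleDr : right_distributive sn_scale +%R.
Proof.
move=> c a b; have [d [x [y [-> ->]]]] := sn_mxP2 a b.
by rewrite -sn_injD !sn_scaleE scalerDr sn_injD.
Qed.

Fact sn_scaleDl a : {morph sn_scale^~ a : c c' / c + c'}.
Proof.
move=> c c'; have [d [x ->]] := sn_mxP a.
by rewrite !sn_scaleE scalerDl sn_injD.
Qed.

HB.instance Definition _ := GRing.Zmodule_isLmodule.Build F sn_mx
  sn_scaleA sn_scale1 sn_scaleDr sn_scaleDl.

Lemma sn_injZ c d (x : 'M[F]_(val d)) : sn_inj (c *: x) = c *: sn_inj x.
Proof. by rewrite -sn_scaleE. Qed.

Fact sn_scaleAl c (a b : sn_mx) : c *: (a * b) = (c *: a) * b.
Proof.
have [d [x [y [-> ->]]]] := sn_mxP2 a b.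
by rewrite -(sn_injZ c x) -!sn_injM -sn_injZ scalemxAl.
Qed.

HB.instance Definition _ := GRing.Lmodule_isLalgebra.Build F sn_mx sn_scaleAl.

Fact sn_scaleAr c (a b : sn_mx) : c *: (a * b) = a * (c *: b).
Proof.
have [d [x [y [-> ->]]]] := sn_mxP2 a b.
by rewrite -(sn_injZ c y) -!sn_injM -sn_injZ scalemxAr.
Qed.

HB.instance Definition _ := GRing.Lalgebra_isAlgebra.Build F sn_mx sn_scaleAr.

End SupernaturalMatrix.

Arguments sn_inj {F s} d x.

Section Presentation.
Variables (F : fieldType) (X : choiceType).

Definition free_alg := {malg F[{fmonom X}]}.
HB.instance Definition _ := GRing.Lalgebra.on free_alg.

Definition free_gen (x : X) : free_alg := << fmu x >>.

Inductive ideal_gen (R : free_alg -> Prop) : free_alg -> Prop :=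
| ideal_gen_in f of R f : ideal_gen R f
| ideal_gen0 : ideal_gen R 0
| ideal_genD f g of ideal_gen R f & ideal_gen R g : ideal_gen R (f + g)
| ideal_genMl f g of ideal_gen R g : ideal_gen R (f * g)
| ideal_genMr f g of ideal_gen R f : ideal_gen R (f * g).

(* A is the unital F-algebra generated by the elements (e x), x : X, subject to
   the relations f = 0, f in R: the evaluation morphism from the free algebra
   induces an isomorphism from its quotient by the two-sided ideal (R) to A. *)
Definition presented_by (A : algType F) (e : X -> A) (R : free_alg -> Prop) :
    Prop :=
  exists phi : {lrmorphism free_alg -> A},
    [/\ forall x, phi (free_gen x) = e x,
        forall a, exists f, phi f = a
      & forall f, phi f = 0 <-> ideal_gen R f].

End Presentation.

Record sn_chain (s : supernatural) := SnChain {
  chain_nat :> nat -> nat;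
  chain0 : chain_nat 0 = 1%N;
  chain_lt : forall t, (chain_nat t < chain_nat t.+1)%N;
  chain_dvd : forall t, (chain_nat t %| chain_nat t.+1)%N;
  chain_lcm : is_sn_lcm chain_nat s
}.

Section Words.
Variables (s : supernatural) (n : sn_chain s).

Lemma chain_gt0 t : (0 < n t)%N.
Proof.
by elim: t => [|t _]; [rewrite chain0 | apply: leq_ltn_trans (chain_lt n t)].
Qed.

Lemma chain_sn_dvd t : is_sn_divisor s (n t).
Proof. by apply/asboolP; split; [exact: chain_gt0 | case: (chain_lcm n)]. Qed.

Definition chain_divisor t : sn_divisor s := Sub (n t) (chain_sn_dvd t).

(* The list [:: k_(t-1); ...; k_0] represents the word k_(t-1)...k_0. *)
Fixpoint is_word (w : seq nat) : bool :=
  if w is k :: v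
  then (k < n (size v).+1 %/ n (size v))%N && is_word v else true.

Fixpoint word_num (w : seq nat) : nat :=
  if w is k :: v then (k * n (size v) + word_num v)%N else 0%N.

Definition word (t : nat) := {w : t.-tuple nat | is_word w}.

Lemma word_num_lt (w : seq nat) : is_word w -> (word_num w < n (size w))%N.
Proof.
elim: w => [|k v IHv] /=; first by rewrite chain0.
case/andP => klt /IHv lt; rewrite -(divnK (chain_dvd n (size v))).
apply: leq_trans (leq_mul klt (leqnn _)).
by rewrite mulSn addnC ltn_add2r.
Qed.

Lemma word_ord_subproof t (w : word t) : (word_num (val w) < n t)%N.
Proof. by have := word_num_lt (valP w); rewrite size_tuple. Qed.

Definition word_ord t (w : word t) : 'I_(n t) := Ordinal (word_ord_subproof w).

Definition word_nil : word 0 :=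
  exist (fun v : 0.-tuple nat => is_word v) [tuple] isT.

Lemma word_cons_subproof t (i : 'I_(n t.+1 %/ n t)) (w : word t) :
  is_word (cons_tuple (nat_of_ord i) (val w)).
Proof. by rewrite /= size_tuple ltn_ord (valP w). Qed.

Definition word_cons t (i : 'I_(n t.+1 %/ n t)) (w : word t) : word t.+1 :=
  exist (fun v : t.+1.-tuple nat => is_word v) _ (word_cons_subproof i w).

Definition word_pair := {t : nat & (word t * word t)%type}.

Variable F : fieldType.

Definition gen_unit t (w w' : word t) : free_alg F word_pair :=
  free_gen F (Tagged (fun t => (word t * word t)%type) (w, w')).

Inductive word_relation : free_alg F word_pair -> Prop :=
| word_rel_mul t (u u' w w' : word t) :
    word_relation (gen_unit u u' * gen_unit w w'
                   - (if u' == w then gen_unit u w' else 0))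
| word_rel_one : word_relation (gen_unit word_nil word_nil - 1)
| word_rel_sum t (w w' : word t) :
    word_relation (gen_unit w w'
      - \sum_(i < n t.+1 %/ n t) gen_unit (word_cons i w) (word_cons i w')).

Definition word_unit (p : word_pair) : sn_mx F s :=
  sn_inj (chain_divisor (tag p))
    (delta_mx (word_ord (tagged p).1) (word_ord (tagged p).2)).

End Words.

(* Main.v *)
(** The free algebra evaluates onto the matrix units.  Modulo the relations,
    (iii) rewrites matrix units of level t as sums of matrix units of any
    higher level, so by (i) and (ii) every element of the free algebra is
    congruent to a linear combination of matrix units of a single level t,
    that is, to the image of a matrix of size n_t.  Such a combination
    evaluates to the class of that matrix, which vanishes only if the matrix
    does because the maps x |-> diag(x, ..., x) are injective.  The evaluation
    is onto because the chain n_t is cofinal among the divisors of s. *)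

Require Import Defs.
From mathcomp Require Import all_boot all_order all_algebra.
From HB Require Import structures.
From mathcomp Require Import boolp.
From mathcomp.multinomials Require Import monalg.

Set Implicit Arguments.
Unset Strict Implicit.
Unset Printing Implicit Defensive.

Import GRing.Theory.
Local Open Scope ring_scope.

(** * The free algebra and evaluation at chosen images of its generators *)

Section FreeAlgebra.
Variables (F : fieldType) (X : choiceType).
Local Notation free_alg := (free_alg F X).

(** A monomial is a word in the generators, built from 1 by left multiplication by one letter at a
    time; linear combinations of monomials then give everything. *)
Lemma free_alg_ind (P : free_alg -> Prop) :
    P 1 -> (forall f g, P f -> P g -> P (f + g)) ->
    (forall c f, P f -> P (c *: f)) ->
    (forall x f, P f -> P (free_gen F x * f)) ->
  forall f, P f.
Proof.
move=> P1 PD PZ PX f.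
have PU (m : {fmonom X}) : P << m >>.
  case: m => m; elim: m => [|x m IHm].
    by rewrite -fmoneE; apply: P1.
  suff -> : << FMonom (x :: m) >> = free_gen F x * << FMonom m >> by apply: PX.
  rewrite malgM_def fgmulUU mulr1; congr << _ >>.
  by rewrite /mmul /= fmmulE fmuE.
rewrite [f]monalgE; apply: (big_ind P) => // [|m _].
  by rewrite -(scale0r 1); apply: PZ.
suff -> : << f@_m *g m >> = f@_m *: (<< m >> : free_alg) by apply/PZ/PU.
by apply/malgP => k; rewrite mcoeffZ !mcoeffU mulr_natr.
Qed.

(** Scaling by [c] is multiplication by a constant supported on the empty word, which commutes with
    [f] because [F] is commutative. *)
Lemma free_alg_scalerAr c (f g : free_alg) : c *: (f * g) = f * (c *: g).
Proof.
rewrite -[in RHS]mul_malgC mulrA scalerAl; congr (_ * g).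
rewrite malgM_def fgmulgU malgZ_def; apply: eq_bigr => m _.
by rewrite mulrC mulm1.
Qed.

Variables (A : algType F) (e : X -> A).

Definition monom_eval (m : {fmonom X}) : A := \prod_(x <- m) e x.

Fact monom_eval_mmorphism : mmorphism monom_eval.
Proof.
by split=> [m m'|]; rewrite /monom_eval ?fmM ?big_cat // fm1 big_nil.
Qed.

HB.instance Definition _ :=
  isMultiplicative.Build {fmonom X} A monom_eval monom_eval_mmorphism.

Definition free_eval : free_alg -> A := mmap (GRing.in_alg A) monom_eval.

Fact free_eval_additive : additive free_eval.
Proof. exact: mmap_is_additive. Qed.

HB.instance Definition _ :=
  GRing.isAdditive.Build free_alg A free_eval free_eval_additive.

(** The target [A] may be noncommutative: it suffices that the images of coefficients, being
    scalars, commute with the images of monomials. *)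
Fact free_eval_multiplicative : multiplicative free_eval.
Proof.
apply: commr_mmap_is_multiplicative => g m m'.
by rewrite /GRing.comm mulr_algl mulr_algr.
Qed.

HB.instance Definition _ :=
  GRing.isMultiplicative.Build free_alg A free_eval free_eval_multiplicative.

Fact free_eval_scalable : scalable free_eval.
Proof. by move=> c f; rewrite /free_eval mmapZ mulr_algl. Qed.

HB.instance Definition _ :=
  GRing.isScalable.Build F free_alg A *:%R free_eval free_eval_scalable.

Lemma free_eval_gen x : free_eval (free_gen F x) = e x.
Proof.
by rewrite /free_eval mmapU /= scale1r mul1r /monom_eval fmU big_seq1.
Qed.

End FreeAlgebra.

(** * Congruence modulo a two-sided ideal *)

Section IdealCongruence.
Variables (F : fieldType) (X : choiceType) (R : free_alg F X -> Prop).
Implicit Types f g h : free_alg F X.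

Definition ideal_eq f g := ideal_gen R (f - g).

Lemma ideal_genZ c f : ideal_gen R f -> ideal_gen R (c *: f).
Proof. by move=> Rf; rewrite -mul_malgC; apply: ideal_genMl. Qed.

Lemma ideal_eq_refl f : ideal_eq f f.
Proof. by rewrite /ideal_eq subrr; apply: ideal_gen0. Qed.

Lemma ideal_eq_sym f g : ideal_eq f g -> ideal_eq g f.
Proof. by move=> /(ideal_genZ (-1)); rewrite scaleN1r opprB. Qed.

Lemma ideal_eq_trans g f h : ideal_eq f g -> ideal_eq g h -> ideal_eq f h.
Proof. by move=> fg /(ideal_genD fg); rewrite addrA subrK. Qed.

Lemma ideal_eqD f f' g g' :
  ideal_eq f f' -> ideal_eq g g' -> ideal_eq (f + g) (f' + g').
Proof. by move=> ff gg; rewrite /ideal_eq opprD addrACA; apply: ideal_genD. Qed.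

Lemma ideal_eqZ c f g : ideal_eq f g -> ideal_eq (c *: f) (c *: g).
Proof. by rewrite /ideal_eq -scalerBr; apply: ideal_genZ. Qed.

Lemma ideal_eqM f f' g g' :
  ideal_eq f f' -> ideal_eq g g' -> ideal_eq (f * g) (f' * g').
Proof.
move=> ff gg; apply: (@ideal_eq_trans (f' * g)).
  by rewrite /ideal_eq -mulrBl; apply: ideal_genMr.
by rewrite /ideal_eq -mulrBr; apply: ideal_genMl.
Qed.

End IdealCongruence.

(** * Matrix units and block-diagonal embeddings *)

Lemma mx_ind_delta (R : pzRingType) p q (P : 'M[R]_(p, q) -> Prop) :
    P 0 -> (forall x y, P x -> P y -> P (x + y)) ->
    (forall c x, P x -> P (c *: x)) -> (forall i j, P (delta_mx i j)) ->
  forall x, P x.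
Proof.
move=> P0 PD PZ Pd x; rewrite [x]matrix_sum_delta.
by apply: (big_ind P) => // i _; apply: (big_ind P) => // j _; apply: PZ.
Qed.

Section DiagRepTheory.
Variables (R : pzRingType) (m k : nat) (m_gt0 : (0 < m)%N).

(** The upper left m x m block of diag(x, ..., x) is x itself. *)
Lemma diag_rep_inj : (m <= k)%N -> injective (@diag_rep R m k m_gt0).
Proof.
move=> mk x y /matrixP xy; apply/matrixP => i j.
have := xy (widen_ord mk i) (widen_ord mk j); rewrite !mxE /= !divn_small //=.
have E (l : 'I_m) : Ordinal (ltn_pmod l m_gt0) = l.
  by apply: val_inj; rewrite /= modn_small.
by rewrite !E.
Qed.

Lemma block_ord_subproof (b : 'I_(k %/ m)) (i : 'I_m) : (b * m + i < k)%N.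
Proof.
apply: leq_trans (leq_divM k m).
apply: leq_trans (leq_mul (ltn_ord b) (leqnn m)).
by rewrite mulSn addnC ltn_add2r.
Qed.

Definition block_ord b i : 'I_k := Ordinal (block_ord_subproof b i).

Lemma diag_rep_delta (i j : 'I_m) : (m %| k)%N ->
  diag_rep k m_gt0 (delta_mx i j : 'M[R]_m)
    = \sum_b delta_mx (block_ord b i) (block_ord b j).
Proof.
move=> mk; apply/matrixP => a b; rewrite summxE mxE.
(* Euclidean division by [m] recovers the block number and the position inside the block. *)
have bE (c : 'I_k) (l : 'I_m) (d : 'I_(k %/ m)) :
    (c == block_ord d l) = (c %/ m == d)%N && (c %% m == l)%N.
  rewrite -val_eqE /=; apply/eqP/andP => [->|[/eqP <- /eqP <-]].
    by rewrite divnMDl // (divn_small (ltn_ord l)) addn0 modnMDl modn_small.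
  by rewrite -divn_eq.
have lt_a : (a %/ m < k %/ m)%N by rewrite ltn_divLR // divnK.
(* Only the block containing row [a] contributes to the entry at (a, b). *)
rewrite (bigD1 (Ordinal lt_a)) //= big1 => [|d]; last first.
  rewrite -val_eqE /= mxE bE => /negPf; rewrite eq_sym => -> //.
rewrite addr0 !mxE !bE eqxx -!val_eqE /= (eq_sym (b %/ m)%N).
by case: eqP; rewrite ?andbF.
Qed.

End DiagRepTheory.

(** * Cofinality of the chain among the divisors of [s] *)

Section Chain.
Variables (s : supernatural) (n : sn_chain s).

Lemma chain_dvd_le t t' : (t <= t')%N -> (n t %| n t')%N.
Proof.
move=> le; rewrite -(subnK le); elim: (_ - t)%N => // l IHl.
exact: dvdn_trans IHl (chain_dvd n _).
Qed.

(** Were all exponents of the [n t] at [p] smaller than that of [d], the lcm [s] would divide a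
    supernatural number whose exponent at [p] is too small for [d] to divide [s]. *)
Lemma chain_logn p d : is_sn_divisor s d -> prime p ->
  exists t, (logn p d <= logn p (n t))%N.
Proof.
move=> /asboolP[_ ds] p_pr; apply: contrapT => /forallNP small.
have lt t : (logn p (n t) < logn p d)%N by rewrite ltnNge; apply/negP/small.
(* A common multiple of all [n t]: infinite away from [p], one less than [d] at [p]. By [lt],
   [logn p d] is positive, so the predecessor is not truncated. *)
pose s' : supernatural :=
  fun q => if val q == p then Some (logn p d).-1 else None.
have /(chain_lcm n).2 /(_ (Sub p p_pr)) : forall t, sn_dvd (sn_of_nat (n t)) s'.
  move=> t q; rewrite /s'; case: eqP => //= ->.
  by rewrite -ltnS (ltn_predK (lt t)).
have := ds (Sub p p_pr); rewrite /s' /sn_of_nat /= eqxx.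
case: (s _) => //= l dl ll; have := leq_trans dl ll.
by rewrite -ltnS (ltn_predK (lt 0)) ltnn.
Qed.

(** Only finitely many primes divide [d], so the largest of the levels found for each of them serves
    for all. *)
Lemma chain_cofinal d : is_sn_divisor s d -> exists t, (d %| n t)%N.
Proof.
move=> ds; have [t tP] : exists t, forall p, p \in primes d ->
    (logn p d <= logn p (n t))%N.
  have : all prime (primes d) by apply/allP => p; rewrite mem_primes => /andP[].
  elim: (primes d) => [|p l IHl] /=; first by exists 0.
  case/andP => /(chain_logn ds)[t' t'P] /IHl[t tP].
  exists (maxn t t') => q; rewrite inE => /orP[/eqP->|/tP dt].
    apply: leq_trans t'P _; apply: dvdn_leq_log (chain_gt0 n _) _.
    exact: chain_dvd_le (leq_maxr _ _).
  apply: leq_trans dt _; apply: dvdn_leq_log (chain_gt0 n _) _.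
  exact: chain_dvd_le (leq_maxl _ _).
exists t; have /asboolP[d_gt0 _] := ds; apply/dvdn_partP => // p pd.
rewrite p_part pfactor_dvdn ?chain_gt0 ?tP //.
by move: pd; rewrite /= mem_primes => /andP[].
Qed.

(** * Mixed-radix expansion: words of length t as indices below [n t] *)

Fixpoint digits t i : seq nat :=
  if t is t'.+1 then (i %/ n t')%N :: digits t' (i %% n t')%N else [::].

Lemma size_digits t i : size (digits t i) == t.
Proof. by elim: t i => //= t IHt i; rewrite eqSS. Qed.

Lemma digits_is_word t i : (i < n t)%N -> is_word n (digits t i).
Proof.
elim: t i => //= t IHt i lt; rewrite (eqP (size_digits _ _)).
rewrite IHt ?ltn_pmod ?chain_gt0 // andbT.
by rewrite ltn_divLR ?chain_gt0 // divnK ?chain_dvd.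
Qed.

Lemma digitsK t i : (i < n t)%N -> word_num n (digits t i) = i.
Proof.
elim: t i => [|t IHt] i /=; first by rewrite chain0 ltnS leqn0 => /eqP.
move=> _; rewrite (eqP (size_digits _ _)) IHt ?ltn_pmod ?chain_gt0 //.
by rewrite -divn_eq.
Qed.

Lemma word_numK w : is_word n w -> digits (size w) (word_num n w) = w.
Proof.
elim: w => //= k w IHw /andP[_ ww]; have lt := word_num_lt ww.
by rewrite divnMDl ?chain_gt0 // modnMDl divn_small // addn0 modn_small // IHw.
Qed.

Definition ord_word t (i : 'I_(n t)) : word n t :=
  exist (fun w : t.-tuple nat => is_word n w) (Tuple (size_digits t i))
    (digits_is_word (ltn_ord i)).

Lemma ord_wordK t : cancel (@ord_word t) (@word_ord s n t).
Proof. by move=> i; apply: val_inj; rewrite /= digitsK. Qed.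

Lemma word_ordK t : cancel (@word_ord s n t) (@ord_word t).
Proof.
move=> w; apply/val_inj/val_inj.
by have := word_numK (valP w); rewrite size_tuple.
Qed.

Lemma word_ord_inj t : injective (@word_ord s n t).
Proof. exact: can_inj (@word_ordK t). Qed.

(** The new digit is the leading one, with weight [n t], so it selects the diagonal block. This is
    what ties relation (iii) to the maps of the direct system. *)
Lemma word_ord_cons t b (w : word n t) :
  word_ord (word_cons b w) = block_ord b (word_ord w).
Proof. by apply: val_inj; rewrite /= size_tuple. Qed.

End Chain.

(** * Matrix combinations modulo the relations *)

Section MatrixCombinations.
Variables (s : supernatural) (n : sn_chain s) (F : fieldType).
Local Notation free_alg := (free_alg F (word_pair n)).
Local Notation "f ≡ g" := (ideal_eq (@word_relation s n F) f g) (at level 70).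
Local Notation phi := (free_eval (@word_unit s n F)).

(** A linear lift of the matrix algebra of level [t] to the free algebra; it respects products and 1
    only modulo the relations. *)
Definition mx_comb t (x : 'M[F]_(n t)) : free_alg :=
  \sum_i \sum_j x i j *: gen_unit F (ord_word i) (ord_word j).

Lemma mx_combD t (x y : 'M[F]_(n t)) : mx_comb (x + y) = mx_comb x + mx_comb y.
Proof.
rewrite /mx_comb -big_split; apply: eq_bigr => i _ /=.
by rewrite -big_split; apply: eq_bigr => j _ /=; rewrite mxE scalerDl.
Qed.

Lemma mx_combZ t c (x : 'M[F]_(n t)) : mx_comb (c *: x) = c *: mx_comb x.
Proof.
rewrite /mx_comb scaler_sumr; apply: eq_bigr => i _.
by rewrite scaler_sumr; apply: eq_bigr => j _; rewrite mxE scalerA.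
Qed.

Lemma mx_comb0 t : mx_comb (0 : 'M[F]_(n t)) = 0.
Proof. by rewrite -(scale0r 0) mx_combZ scale0r. Qed.

Lemma mx_comb_sum t I r (x : I -> 'M[F]_(n t)) :
  mx_comb (\sum_(i <- r) x i) = \sum_(i <- r) mx_comb (x i).
Proof. exact: (big_morph _ (@mx_combD t) (mx_comb0 t)). Qed.

Lemma mx_comb_delta t (i j : 'I_(n t)) :
  mx_comb (delta_mx i j) = gen_unit F (ord_word i) (ord_word j).
Proof.
rewrite /mx_comb (bigD1 i) //= [X in _ + X]big1 => [|k /negPf ki].
  rewrite addr0 (bigD1 j) //= [X in _ + X]big1 => [|k /negPf kj].
    by rewrite mxE !eqxx scale1r addr0.
  by rewrite mxE kj andbF scale0r.
by apply: big1 => l _; rewrite mxE ki scale0r.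
Qed.

Lemma gen_unitE t (w w' : word n t) :
  gen_unit F w w' = mx_comb (delta_mx (word_ord w) (word_ord w')).
Proof. by rewrite mx_comb_delta !word_ordK. Qed.

Lemma delta_nil :
  delta_mx (word_ord (word_nil n)) (word_ord (word_nil n)) = 1%:M
    :> 'M[F]_(n 0).
Proof.
have n0_eq0 (i : 'I_(n 0)) : i = word_ord (word_nil n).
  apply: val_inj => /=; move: (ltn_ord i).
  by rewrite [X in (_ < X)%N]chain0 ltnS leqn0 => /eqP.
by apply/matrixP => i j; rewrite !mxE !(n0_eq0 i) !(n0_eq0 j) eqxx.
Qed.

Lemma mx_comb1 : mx_comb (1%:M : 'M[F]_(n 0)) ≡ 1.
Proof. by rewrite -delta_nil -gen_unitE; apply/ideal_gen_in/word_rel_one. Qed.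

(** Both sides are bilinear, and on two matrix units the congruence is relation (i). *)
Lemma mx_combM t (x y : 'M[F]_(n t)) :
  mx_comb x * mx_comb y ≡ mx_comb (x *m y).
Proof.
elim/mx_ind_delta: x y => [|x x' IHx IHx'|c x IHx|i j] y.
- by rewrite mul0mx mx_comb0 mul0r; apply: ideal_eq_refl.
- by rewrite mulmxDl !mx_combD mulrDl; apply: ideal_eqD.
- by rewrite -scalemxAl !mx_combZ -scalerAl; apply: ideal_eqZ.
elim/mx_ind_delta: y => [|y y' IHy IHy'|c y IHy|k l].
- by rewrite mulmx0 mx_comb0 mulr0; apply: ideal_eq_refl.
- by rewrite mulmxDr !mx_combD mulrDr; apply: ideal_eqD.
- by rewrite -scalemxAr !mx_combZ -free_alg_scalerAr; apply: ideal_eqZ.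
rewrite mul_delta_mx_cond; have := word_rel_mul F (ord_word i) (ord_word j)
  (ord_word k) (ord_word l) => /ideal_gen_in.
rewrite (can_eq (@ord_wordK _ _ t)) !mx_comb_delta.
by case: eqP => _; rewrite ?mulr1n ?mulr0n ?mx_comb_delta ?mx_comb0.
Qed.

Definition chain_diag t t' (x : 'M[F]_(n t)) : 'M[F]_(n t') :=
  diag_rep (n t') (chain_gt0 n t) x.

Lemma chain_diagD t t' (x y : 'M[F]_(n t)) :
  chain_diag t' (x + y) = chain_diag t' x + chain_diag t' y.
Proof. exact: diag_repD. Qed.

Lemma chain_diagZ t t' c (x : 'M[F]_(n t)) :
  chain_diag t' (c *: x) = c *: chain_diag t' x.
Proof. exact: diag_repZ. Qed.

Lemma sn_inj_chain_diag t t' (x : 'M[F]_(n t)) : (t <= t')%N ->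
  sn_inj (chain_divisor n t') (chain_diag t' x) = sn_inj (chain_divisor n t) x.
Proof.
move=> le.
rewrite -[RHS](@sn_inj_diag _ _ _ (chain_divisor n t')) ?chain_dvd_le //.
rewrite /chain_diag /sn_diag; congr (sn_inj _ (diag_rep _ _ x)).
(* The two sides differ only in the proof that [n t] is positive. *)
exact: bool_irrelevance.
Qed.

Lemma sum_gen_unit t (w w' : word n t) :
  \sum_b gen_unit F (word_cons b w) (word_cons b w')
    = mx_comb (chain_diag t.+1 (delta_mx (word_ord w) (word_ord w'))).
Proof.
rewrite /chain_diag diag_rep_delta ?chain_dvd // mx_comb_sum.
by apply: eq_bigr => b _; rewrite gen_unitE !word_ord_cons.
Qed.

(** By linearity it is enough to treat a matrix unit, where this is relation (iii). *)
Lemma mx_comb_diagS t (x : 'M[F]_(n t)) :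
  mx_comb x ≡ mx_comb (chain_diag t.+1 x).
Proof.
elim/mx_ind_delta: x => [|x y IHx IHy|c x IHx|i j].
- by rewrite /chain_diag diag_rep0 !mx_comb0; apply: ideal_eq_refl.
- rewrite chain_diagD (mx_combD x) (mx_combD (chain_diag _ x)).
  exact (ideal_eqD IHx IHy).
- rewrite chain_diagZ (mx_combZ _ x) (mx_combZ _ (chain_diag _ x)).
  exact (ideal_eqZ c IHx).
rewrite -(ord_wordK i) -(ord_wordK j) -sum_gen_unit -gen_unitE.
exact/ideal_gen_in/word_rel_sum.
Qed.

Lemma normal_form_le f t t' : (t <= t')%N ->
  (exists x : 'M[F]_(n t), f ≡ mx_comb x) ->
  exists x : 'M[F]_(n t'), f ≡ mx_comb x.
Proof.
move=> le; rewrite -(subnK le); elim: (_ - t)%N => // l IHl /IHl[x fx].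
exists (chain_diag (l + t).+1 x).
exact: ideal_eq_trans fx (mx_comb_diagS x).
Qed.

Lemma normal_form f : exists t (x : 'M[F]_(n t)), f ≡ mx_comb x.
Proof.
(* Two normal forms can be raised to the larger of their levels, where they can be added and
   multiplied as matrices. *)
have lift2 (g h : free_alg) : (exists t (x : 'M[F]_(n t)), g ≡ mx_comb x) ->
    (exists t (x : 'M[F]_(n t)), h ≡ mx_comb x) ->
    exists t (x y : 'M[F]_(n t)), g ≡ mx_comb x /\ h ≡ mx_comb y.
  move=> [t gx] [t' hx]; exists (maxn t t').
  have [x gx'] := normal_form_le (leq_maxl t t') gx.
  by have [y hy] := normal_form_le (leq_maxr t t') hx; exists x, y.
elim/free_alg_ind: f => [|f g IHf IHg|c f [t [x fx]]|[t [w w']] f IHf].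
- by exists 0, 1%:M; apply/ideal_eq_sym/mx_comb1.
- have [t [x [y [fx gy]]]] := lift2 _ _ IHf IHg.
  by exists t, (x + y); rewrite mx_combD; apply: ideal_eqD.
- by exists t, (c *: x); rewrite mx_combZ; apply: ideal_eqZ.
have IHw : exists t (x : 'M[F]_(n t)), gen_unit F w w' ≡ mx_comb x.
  by exists t, (delta_mx (word_ord w) (word_ord w')); rewrite gen_unitE;
    apply: ideal_eq_refl.
have [k [x [y [wx fy]]]] := lift2 _ _ IHw IHf.
exists k, (x *m y).
exact: ideal_eq_trans (ideal_eqM wx fy) (mx_combM x y).
Qed.

(** * Evaluation in the direct limit: kernel and image *)

Lemma eval_gen_unit t (w w' : word n t) : phi (gen_unit F w w') =
  sn_inj (chain_divisor n t) (delta_mx (word_ord w) (word_ord w')).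
Proof. exact: free_eval_gen. Qed.

Lemma eval_mx_comb t (x : 'M[F]_(n t)) :
  phi (mx_comb x) = sn_inj (chain_divisor n t) x.
Proof.
elim/mx_ind_delta: x => [|x y IHx IHy|c x IHx|i j].
- by rewrite mx_comb0 rmorph0 -sn_zeroE.
- by rewrite mx_combD rmorphD /= IHx IHy -sn_injD.
- by rewrite mx_combZ linearZ /= IHx -sn_injZ.
by rewrite mx_comb_delta eval_gen_unit !ord_wordK.
Qed.

Lemma eval_relation f : word_relation f -> phi f = 0.
Proof.
case=> [t u u' w w'||t w w'].
- rewrite rmorphB rmorphM /= !eval_gen_unit -sn_injM mul_delta_mx_cond.
  rewrite (inj_eq (@word_ord_inj _ n t)); case: eqP => _.
    by rewrite eval_gen_unit mulr1n subrr.
  by rewrite mulr0n -sn_zeroE rmorph0 subrr.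
- rewrite rmorphB rmorph1 /= eval_gen_unit delta_nil.
  by apply/eqP; rewrite subr_eq0; apply/eqP/esym/sn_oneE.
rewrite sum_gen_unit rmorphB /= eval_gen_unit eval_mx_comb.
by rewrite sn_inj_chain_diag ?subrr.
Qed.

Lemma eval_ideal f : ideal_gen (@word_relation s n F) f -> phi f = 0.
Proof.
elim=> {f} [f /eval_relation //||f g _ IHf _ IHg|f g _ IHg|f g _ IHf].
- by rewrite rmorph0.
- by rewrite rmorphD /= IHf IHg addr0.
- by rewrite rmorphM /= IHg mulr0.
by rewrite rmorphM /= IHf mul0r.
Qed.

Lemma eval_inj f : phi f = 0 -> ideal_gen (@word_relation s n F) f.
Proof.
move=> f0; have [t [x fx]] := normal_form f.
suff x0 : x = 0 by move: fx; rewrite x0 mx_comb0 /ideal_eq subr0.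
have /eqP := eval_ideal fx; rewrite rmorphB /= f0 eval_mx_comb sub0r oppr_eq0.
(* Taking zero at level [t] makes both sides images under one embedding, into the size of some
   divisor [k] that [n t] divides; hence [n t] is at most that size and the embedding is
   injective. *)
move/eqP; rewrite [RHS](sn_zeroE F (chain_divisor n t)) => /sn_injP[k [tk _]].
by apply: diag_rep_inj; apply: dvdn_leq tk; apply: sn_divisor_gt0.
Qed.

Lemma eval_surj a : exists f, phi f = a.
Proof.
have [d [x ->]] := sn_mxP a; have [t dt] := chain_cofinal n (valP d).
exists (mx_comb (sn_diag (chain_divisor n t) x)).
by rewrite eval_mx_comb sn_inj_diag.
Qed.

End MatrixCombinations.

Theorem theorem1p1 (F : fieldType) (s : supernatural) (n : nat -> nat)
    (n0 : n 0 = 1%N) (n_lt : forall t, (n t < n t.+1)%N)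
    (n_dvd : forall t, (n t %| n t.+1)%N) (n_lcm : is_sn_lcm n s) :
  let c := SnChain n0 n_lt n_dvd n_lcm in
  presented_by (@word_unit s c F) (@word_relation s c F).
Proof.
move=> c; exists (free_eval (@word_unit s c F)); split.
- exact: free_eval_gen.
- exact: eval_surj.
by move=> f; split; [exact: eval_inj | exact: eval_ideal].
Qed.
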